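(* Let $b_A(t),b_B(t)$ be arbitrary real functions and $z$ the deformation parameter. Consider the deformed system $$\frac{\mathrm{d}x}{\mathrm{d}t}=b_A(t)\,\frac{\mathrm{e}^{zx}-1}{z},\qquad \frac{\mathrm{d}y}{\mathrm{d}t}=-b_A(t)\,\mathrm{e}^{zx}y+b_B(t),$$ and its first-order approximation in $z$, $$\frac{\mathrm{d}x}{\mathrm{d}t}=b_A(t)\left(x+\tfrac12 z x^2\right),\qquad \frac{\mathrm{d}y}{\mathrm{d}t}=-b_A(t)\left(y+z\,xy\right)+b_B(t)$$ (obtained by expanding in powers of $z$ and dropping the terms of order $z^2$ and higher). The change of variables $x=\frac{1}{zu}$ reduces the first equation, a real Bernoulli equation, to the linear equation $\frac{\mathrm{d}u}{\mathrm{d}t}=-b_A(t)\left(u+\tfrac12\right)$, and the general solution of the first-order approximation is given by quadratures as $$x(t)=2c_1\left(2\,\mathrm{e}^{-\gamma(t)}-zc_1\right)^{-1},\qquad y(t)=\mathrm{e}^{-\xi(t)}\left(c_2+\int_a^t b_B(\tau)\,\mathrm{e}^{\xi(\tau)}\,\mathrm{d}\tau\right),$$ $$\gamma(t)=\int_a^t b_A(s)\,\mathrm{d}s,\qquad \xi(t)=\int_a^t b_A(s)\bigl(1+z\,x(s)\bigr)\,\mathrm{d}s,$$ with integration constants $c_1,c_2$.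
   Context: Here $a$ is an appropriate real number ensuring that the integrals exist. The approximation is meant for small values of $z$.
   Formalization: For the general solution, b_A and b_B are taken continuous on the open interval of definition (containing a) rather than arbitrary, and the singular solution x = -2/z, which the formula with constants c_1, c_2 misses, is listed as an exception. *)

(* Defs.v *)
From Stdlib Require Import Reals.
From Coquelicot Require Import Coquelicot.
Open Scope R_scope.

(* Right-hand sides of the deformed system (meaningful for z <> 0). *)
Definition deformed_x (bA : R -> R) (z t x : R) : R :=
  bA t * ((exp (z * x) - 1) / z).
Definition deformed_y (bA bB : R -> R) (z t x y : R) : R :=
  - bA t * exp (z * x) * y + bB t.

(* Right-hand sides of the first-order system. *)
Definition first_order_x (bA : R -> R) (z t x : R) : R :=
  bA t * (x + / 2 * z * x ^ 2).
Definition first_order_y (bA bB : R -> R) (z t x y : R) : R :=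
  - bA t * (y + z * (x * y)) + bB t.

(* [g] is the power series of [f] at 0 with the terms of order 2 and higher
   dropped. The neighbourhood is punctured because [deformed_x] divides by z. *)
Definition first_order_truncation (f g : R -> R) : Prop :=
  exists c : nat -> R,
    locally' 0 (fun z => is_pseries c z (f z)) /\
    (forall z : R, g z = c 0%nat + c 1%nat * z).

Definition bernoulli_rhs (P Q : R -> R) (n : nat) (t x : R) : R :=
  P t * x + Q t * x ^ n.

Definition Rbar_open_interval (lo hi : Rbar) (t : R) : Prop :=
  Rbar_lt lo t /\ Rbar_lt t hi.

Definition solves_first_order_x (J : R -> Prop) (bA : R -> R) (z : R)
    (x : R -> R) : Prop :=
  forall t : R, J t -> is_derive x t (first_order_x bA z t (x t)).

Definition solves_first_order_system (J : R -> Prop) (bA bB : R -> R) (z : R)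
    (x y : R -> R) : Prop :=
  solves_first_order_x J bA z x /\
  forall t : R, J t -> is_derive y t (first_order_y bA bB z t (x t) (y t)).

Definition solves_linear_u (J : R -> Prop) (bA : R -> R) (u : R -> R) : Prop :=
  forall t : R, J t -> is_derive u t (- bA t * (u t + / 2)).

Definition gamma (bA : R -> R) (a t : R) : R := RInt bA a t.

Definition xi_integrand (bA : R -> R) (z : R) (x : R -> R) (s : R) : R :=
  bA s * (1 + z * x s).
Definition xi (bA : R -> R) (z a : R) (x : R -> R) (t : R) : R :=
  RInt (xi_integrand bA z x) a t.

Definition y_integrand (bA bB : R -> R) (z a : R) (x : R -> R) (s : R) : R :=
  bB s * exp (xi bA z a x s).

Definition given_by_quadratures (J : R -> Prop) (bA bB : R -> R) (z a : R)
    (c1 c2 : R) (x y : R -> R) : Prop :=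
  forall t : R, J t ->
    2 * exp (- gamma bA a t) - z * c1 <> 0 /\
    x t = 2 * c1 * / (2 * exp (- gamma bA a t) - z * c1) /\
    y t = exp (- xi bA z a x t) *
          (c2 + RInt (y_integrand bA bB z a x) a t).

(* [RInt] is total, so the existence of the integrals is a separate fact. *)
Definition quadratures_exist (J : R -> Prop) (bA bB : R -> R) (z a : R)
    (x : R -> R) : Prop :=
  forall t : R, J t ->
    ex_RInt bA a t /\
    ex_RInt (xi_integrand bA z x) a t /\
    ex_RInt (y_integrand bA bB z a x) a t.

(* Main.v *)
Require Import Defs.
From Stdlib Require Import Reals Factorial Lra.
From Coquelicot Require Import Coquelicot.
Open Scope R_scope.

(** The Bernoulli equation is linear in two disguises.  With [w = 2 + z x] one
    has [w' = (bA z x / 2) w], so [w] vanishes either identically or nowhere;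
    in the second case [p = x / w] satisfies [p' = bA p], and solving
    [p = p(a) exp(gamma)] for [x] gives the stated formula with [c1 = 2 p(a)].
    The equation for [y] is linear with coefficient [- bA (1 + z x)]. *)

(** * Calculus on open intervals with possibly infinite endpoints *)

Lemma Rbar_open_interval_locally (lo hi : Rbar) (t : R) :
  Rbar_open_interval lo hi t -> locally t (Rbar_open_interval lo hi).
Proof.
intros Ht.
exact (open_and _ _ (open_Rbar_gt lo) (open_Rbar_lt hi) t Ht).
Qed.

Lemma Rbar_open_interval_convex (lo hi : Rbar) (a t s : R) :
  Rbar_open_interval lo hi a -> Rbar_open_interval lo hi t ->
  Rmin a t <= s <= Rmax a t -> Rbar_open_interval lo hi s.
Proof.
intros [Ha1 Ha2] [Ht1 Ht2] [Hs1 Hs2].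
split.
- apply Rbar_lt_le_trans with (Rmin a t); [|exact Hs1].
  unfold Rmin; destruct (Rle_dec a t); assumption.
- apply Rbar_le_lt_trans with (Rmax a t); [exact Hs2|].
  unfold Rmax; destruct (Rle_dec a t); assumption.
Qed.

Lemma ex_RInt_open_interval (lo hi : Rbar) (f : R -> R) (a t : R) :
  (forall s, Rbar_open_interval lo hi s -> continuous f s) ->
  Rbar_open_interval lo hi a -> Rbar_open_interval lo hi t -> ex_RInt f a t.
Proof.
intros Hf Ha Ht.
apply (@ex_RInt_continuous R_CompleteNormedModule).
intros s Hs; apply Hf; exact (Rbar_open_interval_convex _ _ _ _ _ Ha Ht Hs).
Qed.

Lemma is_derive_RInt_open_interval (lo hi : Rbar) (f : R -> R) (a t : R) :
  (forall s, Rbar_open_interval lo hi s -> continuous f s) ->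
  Rbar_open_interval lo hi a -> Rbar_open_interval lo hi t ->
  is_derive (fun t => RInt f a t) t (f t).
Proof.
intros Hf Ha Ht.
apply (is_derive_RInt f (fun t => RInt f a t) a t); [|exact (Hf t Ht)].
apply filter_imp with (2 := Rbar_open_interval_locally _ _ _ Ht).
intros s Hs; apply (@RInt_correct R_CompleteNormedModule).
now apply (ex_RInt_open_interval lo hi).
Qed.

Lemma continuous_exp_RInt (lo hi : Rbar) (k : R -> R) (a t : R) :
  (forall s, Rbar_open_interval lo hi s -> continuous k s) ->
  Rbar_open_interval lo hi a -> Rbar_open_interval lo hi t ->
  continuous (fun t => exp (RInt k a t)) t.
Proof.
intros Hk Ha Ht.
apply continuous_comp; [|apply continuous_exp].
apply (@ex_derive_continuous R_AbsRing R_NormedModule); eexists.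
now apply (is_derive_RInt_open_interval lo hi).
Qed.

Lemma is_derive_0_constant (lo hi : Rbar) (f : R -> R) (a t : R) :
  (forall s, Rbar_open_interval lo hi s -> is_derive f s 0) ->
  Rbar_open_interval lo hi a -> Rbar_open_interval lo hi t -> f t = f a.
Proof.
intros Hf Ha Ht.
assert (Hd : forall s, Rmin a t <= s <= Rmax a t -> is_derive f s 0).
{ intros s Hs; apply Hf; exact (Rbar_open_interval_convex _ _ _ _ _ Ha Ht Hs). }
destruct (Rtotal_order a t) as [H | [-> | H]]; [|reflexivity|].
- symmetry; apply (@eq_is_derive R_NormedModule f a t); [|exact H].
  intros s Hs; apply Hd; rewrite Rmin_left, Rmax_right; lra.
- apply (@eq_is_derive R_NormedModule f t a); [|exact H].
  intros s Hs; apply Hd; rewrite Rmin_right, Rmax_left; lra.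
Qed.

(** * Linear first-order equations: existence and uniqueness by integrating factors *)

Lemma variation_of_constants_is_derive (lo hi : Rbar) (k b : R -> R) (a c t : R) :
  (forall s, Rbar_open_interval lo hi s -> continuous k s) ->
  (forall s, Rbar_open_interval lo hi s -> continuous b s) ->
  Rbar_open_interval lo hi a -> Rbar_open_interval lo hi t ->
  let f t := exp (- RInt k a t) *
             (c + RInt (fun s => b s * exp (RInt k a s)) a t) in
  is_derive f t (- k t * f t + b t).
Proof.
intros Hk Hb Ha Ht f; unfold f.
pose proof (is_derive_RInt_open_interval _ _ _ _ _ Hk Ha Ht) as HK.
assert (HB : is_derive (fun t => RInt (fun s => b s * exp (RInt k a s)) a t) t
                       (b t * exp (RInt k a t))).
{ apply (is_derive_RInt_open_interval lo hi (fun s => b s * exp (RInt k a s)));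
    [|assumption ..].
  intros s Hs; apply (continuous_mult b); [now apply Hb|].
  now apply (continuous_exp_RInt lo hi). }
(* Replacing the integrals by arbitrary [K] and [B] with the same derivatives lets [auto_derive]
   treat them as opaque functions. The same device recurs below. *)
assert (Hprod : forall K B : R -> R,
  is_derive K t (k t) -> is_derive B t (b t * exp (K t)) ->
  is_derive (fun t => exp (- K t) * (c + B t)) t
            (- k t * (exp (- K t) * (c + B t)) + b t)).
{ clear HK HB; intros K B HK HB.
  auto_derive; [repeat split; eexists; eassumption |].
  rewrite (is_derive_unique (fun x : R => K x) _ _ HK),
    (is_derive_unique (fun x : R => B x) _ _ HB).
  rewrite exp_Ropp; field; apply Rgt_not_eq, exp_pos. }
exact (Hprod _ _ HK HB).
Qed.

(** The difference of two solutions satisfies the homogeneous equation, so its product with the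
    integrating factor [exp (RInt k a t)] has zero derivative. That product vanishes at [a], hence
    everywhere on the interval. *)
Lemma variation_of_constants_unique (lo hi : Rbar) (k b f : R -> R) (a t : R) :
  (forall s, Rbar_open_interval lo hi s -> continuous k s) ->
  (forall s, Rbar_open_interval lo hi s -> continuous b s) ->
  (forall s, Rbar_open_interval lo hi s -> is_derive f s (- k s * f s + b s)) ->
  Rbar_open_interval lo hi a -> Rbar_open_interval lo hi t ->
  f t = exp (- RInt k a t) *
        (f a + RInt (fun s => b s * exp (RInt k a s)) a t).
Proof.
intros Hk Hb Hf Ha Ht.
set (g := fun t => exp (- RInt k a t) *
                   (f a + RInt (fun s => b s * exp (RInt k a s)) a t)).
change (f t = g t).
assert (Hc : (f t - g t) * exp (RInt k a t) = (f a - g a) * exp (RInt k a a)).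
{ apply (is_derive_0_constant lo hi (fun t => (f t - g t) * exp (RInt k a t)));
    [|assumption ..].
  intros s Hs.
  pose proof (is_derive_RInt_open_interval _ _ _ _ _ Hk Ha Hs) as HK.
  assert (Hg : is_derive g s (- k s * g s + b s)).
  { now apply (variation_of_constants_is_derive lo hi). }
  assert (Hprod : forall K h : R -> R,
    is_derive K s (k s) -> is_derive h s (- k s * h s + b s) ->
    is_derive (fun t => (f t - h t) * exp (K t)) s 0).
  { clear HK Hg; intros K h HK Hh; specialize (Hf s Hs).
    auto_derive; [repeat split; eexists; eassumption |].
    rewrite (is_derive_unique (fun x : R => K x) _ _ HK),
      (is_derive_unique (fun x : R => f x) _ _ Hf),
      (is_derive_unique (fun x : R => h x) _ _ Hh); ring. }
  exact (Hprod _ _ HK Hg). }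
assert (Hga : g a = f a).
{ unfold g; rewrite !RInt_point; unfold zero; simpl.
  rewrite Ropp_0, exp_0; ring. }
rewrite Hga in Hc.
pose proof (exp_pos (RInt k a t)).
assert (Hm : (f t - g t) * exp (RInt k a t) = 0) by (rewrite Hc; ring).
apply Rmult_integral in Hm; lra.
Qed.

(** The conserved quantity is [f t * exp (- RInt k a t)]. The sign of [k] is opposite to the one in
    the two preceding lemmas. No division by [f] occurs, so [f] may vanish. *)
Lemma homogeneous_linear_unique (lo hi : Rbar) (k f : R -> R) (a t : R) :
  (forall s, Rbar_open_interval lo hi s -> continuous k s) ->
  (forall s, Rbar_open_interval lo hi s -> is_derive f s (k s * f s)) ->
  Rbar_open_interval lo hi a -> Rbar_open_interval lo hi t ->
  f t = f a * exp (RInt k a t).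
Proof.
intros Hk Hf Ha Ht.
assert (Hc : f t * exp (- RInt k a t) = f a * exp (- RInt k a a)).
{ apply (is_derive_0_constant lo hi (fun t => f t * exp (- RInt k a t)));
    [|assumption ..].
  intros s Hs.
  pose proof (is_derive_RInt_open_interval _ _ _ _ _ Hk Ha Hs) as HK.
  assert (Hprod : forall K : R -> R,
    is_derive K s (k s) -> is_derive (fun t => f t * exp (- K t)) s 0).
  { clear HK; intros K HK; specialize (Hf s Hs).
    auto_derive; [repeat split; eexists; eassumption |].
    rewrite (is_derive_unique (fun x : R => K x) _ _ HK),
      (is_derive_unique (fun x : R => f x) _ _ Hf); ring. }
  exact (Hprod _ HK). }
rewrite RInt_point in Hc; unfold zero in Hc; simpl in Hc.
rewrite Ropp_0, exp_0, Rmult_1_r in Hc.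
rewrite <- Hc, Rmult_assoc, <- exp_plus, Rplus_opp_l, exp_0; ring.
Qed.

(** * Power series in the deformation parameter *)

Lemma is_pseries_exp_scal (x z : R) :
  is_pseries (fun n => x ^ n / INR (fact n)) z (exp (z * x)).
Proof.
apply is_pseries_R.
apply is_series_ext with (2 := proj1 (is_pseries_R _ _ _) (is_exp_Reals (z * x))).
intros n; simpl; rewrite Rpow_mult_distr; unfold Rdiv; ring.
Qed.

(** Subtracting the constant term of the exponential series and dividing by [z] shifts the
    coefficients by one place. *)
Lemma is_pseries_expm1_div (x z : R) :
  z <> 0 ->
  is_pseries (fun n => x ^ S n / INR (fact (S n))) z ((exp (z * x) - 1) / z).
Proof.
intros Hz.
replace ((exp (z * x) - 1) / z)
  with (scal (/ z) (plus (exp (z * x)) (opp (x ^ 0 / INR (fact 0))))).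
- apply (is_pseries_decr_1 (fun n => x ^ n / INR (fact n)) z (/ z)).
  + unfold mult, one; simpl; field; exact Hz.
  + apply is_pseries_exp_scal.
- unfold scal, plus, opp; simpl; unfold mult; simpl; field; exact Hz.
Qed.

Lemma first_order_truncation_deformed_x (bA : R -> R) (t x : R) :
  first_order_truncation (fun z => deformed_x bA z t x)
                         (fun z => first_order_x bA z t x).
Proof.
exists (PS_scal (bA t) (fun n => x ^ S n / INR (fact (S n)))); split.
(* The series converges for every [z], so the radius 1 is arbitrary; the puncture supplies
   [z <> 0]. *)
- exists posreal_one; intros z _ Hz.
  refine (is_pseries_scal (bA t) _ z ((exp (z * x) - 1) / z) (Rmult_comm _ _) _).
  now apply is_pseries_expm1_div.
- intros z; unfold first_order_x, PS_scal, scal; simpl; unfold mult; simpl; field.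
Qed.

Lemma first_order_truncation_deformed_y (bA bB : R -> R) (t x y : R) :
  first_order_truncation (fun z => deformed_y bA bB z t x y)
                         (fun z => first_order_y bA bB z t x y).
Proof.
(* The inhomogeneous term [bB t] does not depend on [z]: its power series is the constant one. *)
set (e := fun n : nat => match n with O => bB t | S _ => 0 end).
exists (PS_plus (PS_scal (- bA t * y) (fun n => x ^ n / INR (fact n))) e); split.
- exists posreal_one; intros z _ _.
  replace (deformed_y bA bB z t x y)
    with (plus (scal (- bA t * y) (exp (z * x))) (bB t)).
  + apply (is_pseries_plus _ e z (scal (- bA t * y) (exp (z * x))) (bB t)).
    * refine (is_pseries_scal (- bA t * y) _ z (exp (z * x)) (Rmult_comm _ _) _).
      apply is_pseries_exp_scal.
    * unfold is_pseries.
      apply is_series_ext with (fun n => match n with O => bB t | S _ => 0 end).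
      { intros [|n]; unfold e, scal; simpl; unfold mult, one; simpl; ring. }
      apply (is_series_decr_1 (V := R_NormedModule)).
      unfold plus, opp; simpl; rewrite Rplus_opp_r.
      apply filterlim_ext with (fun _ => 0); [|apply filterlim_const].
      intros n; rewrite sum_n_const; ring.
  + unfold deformed_y, plus, scal; simpl; unfold mult; simpl; ring.
- intros z; unfold first_order_y, PS_plus, PS_scal, e, scal, plus; simpl.
  unfold mult; simpl; field.
Qed.

(** * Reduction of the Bernoulli equation to a linear one *)

Lemma bernoulli_substitution (z : R) (bA x u : R -> R) (lo hi : Rbar) :
  z <> 0 ->
  (forall t, Rbar_open_interval lo hi t -> u t <> 0 /\ x t = 1 / (z * u t)) ->
  solves_first_order_x (Rbar_open_interval lo hi) bA z x <->
  solves_linear_u (Rbar_open_interval lo hi) bA u.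
Proof.
intros Hz Hxu; split; intros H t Ht; specialize (H t Ht);
  destruct (Hxu t Ht) as [Hut Hxt].
(* The substitution is an involution: [u = 1 / (z x)]. It is known on the interval only, which is
   open, so the two functions agree near [t]. *)
- apply is_derive_ext_loc with (fun s => / (z * x s)).
  { apply filter_imp with (2 := Rbar_open_interval_locally _ _ _ Ht).
    intros s Hs; destruct (Hxu s Hs) as [Hus ->].
    change (/ (z * (1 / (z * u s))) = u s); field; now split. }
  assert (Hx0 : z * x t <> 0).
  { rewrite Hxt; replace (z * (1 / (z * u t))) with (/ u t)
      by (field; now split).
    now apply Rinv_neq_0_compat. }
  auto_derive; [split; [eexists; exact H | now split]|].
  rewrite (is_derive_unique (fun s : R => x s) _ _ H); unfold first_order_x; rewrite Hxt.
  field; now split.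
- apply is_derive_ext_loc with (fun s => 1 / (z * u s)).
  { apply filter_imp with (2 := Rbar_open_interval_locally _ _ _ Ht).
    intros s Hs; destruct (Hxu s Hs) as [_ Hx]; now symmetry. }
  auto_derive; [split; [eexists; exact H | split; [|exact I]]|].
  { now apply Rmult_integral_contrapositive_currified. }
  rewrite (is_derive_unique (fun s : R => u s) _ _ H); unfold first_order_x; rewrite Hxt.
  field; now split.
Qed.

(** * The general solution of the first-order system by quadratures *)

Section GeneralSolution.

Context (bA bB : R -> R) (z a : R) (lo hi : Rbar).
Let J := Rbar_open_interval lo hi.
Hypothesis Ha : J a.
Hypothesis HA : forall t, J t -> continuous bA t.
Hypothesis HB : forall t, J t -> continuous bB t.

Lemma solves_first_order_x_continuous (x : R -> R) :
  solves_first_order_x J bA z x -> forall t, J t -> continuous x t.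
Proof.
intros Hx t Ht; apply (@ex_derive_continuous R_AbsRing R_NormedModule).
eexists; exact (Hx t Ht).
Qed.

Lemma xi_integrand_continuous (x : R -> R) :
  solves_first_order_x J bA z x ->
  forall t, J t -> continuous (xi_integrand bA z x) t.
Proof.
intros Hx t Ht; unfold xi_integrand.
apply (continuous_mult bA); [now apply HA|].
apply (continuous_plus (fun _ => 1)); [apply continuous_const|].
apply (continuous_mult (fun _ => z)); [apply continuous_const|].
now apply solves_first_order_x_continuous.
Qed.

(** A solution [x] is differentiable, hence continuous, so all three integrands are continuous on
    the interval. *)
Lemma quadratures_exist_of_solution (x : R -> R) :
  solves_first_order_x J bA z x -> quadratures_exist J bA bB z a x.
Proof.
intros Hx t Ht.
pose proof (xi_integrand_continuous x Hx) as Hxi.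
repeat split; try (now apply (ex_RInt_open_interval lo hi)).
apply (ex_RInt_open_interval lo hi); [|assumption..].
intros s Hs; apply (continuous_mult bB); [now apply HB|].
now apply (continuous_exp_RInt lo hi).
Qed.

(** With [D = 2 exp(-gamma) - z c1] one has [D' = - bA (D + z c1)]. Hence [x = 2 c1 / D] gives
    [x' = bA x (1 + z c1 / D)], and [z c1 / D = z x / 2]. *)
Lemma quadrature_solves_x (c1 : R) (x : R -> R) :
  (forall t, J t ->
     2 * exp (- gamma bA a t) - z * c1 <> 0 /\
     x t = 2 * c1 * / (2 * exp (- gamma bA a t) - z * c1)) ->
  solves_first_order_x J bA z x.
Proof.
intros Hq t Ht; destruct (Hq t Ht) as [HD Hxt].
apply is_derive_ext_loc
  with (fun s => 2 * c1 * / (2 * exp (- gamma bA a s) - z * c1)).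
{ apply filter_imp with (2 := Rbar_open_interval_locally _ _ _ Ht).
  intros s Hs; symmetry; now apply Hq. }
pose proof (is_derive_RInt_open_interval _ _ _ _ _ HA Ha Ht) as HG.
assert (Hquot : forall G : R -> R,
  is_derive G t (bA t) -> 2 * exp (- G t) - z * c1 <> 0 ->
  is_derive (fun s => 2 * c1 * / (2 * exp (- G s) - z * c1)) t
            (first_order_x bA z t (2 * c1 * / (2 * exp (- G t) - z * c1)))).
{ clear HD HG; intros G HG HD; unfold first_order_x.
  auto_derive; [repeat split; [eexists; eassumption | exact HD]|].
  rewrite (is_derive_unique (fun x : R => G x) _ _ HG); field; exact HD. }
rewrite Hxt; exact (Hquot _ HG HD).
Qed.

Lemma quadrature_solves_y (c2 : R) (x y : R -> R) :
  solves_first_order_x J bA z x ->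
  (forall t, J t ->
     y t = exp (- xi bA z a x t) * (c2 + RInt (y_integrand bA bB z a x) a t)) ->
  forall t, J t -> is_derive y t (first_order_y bA bB z t (x t) (y t)).
Proof.
intros Hx Hy t Ht.
apply is_derive_ext_loc with (fun t =>
  exp (- xi bA z a x t) * (c2 + RInt (y_integrand bA bB z a x) a t)).
{ apply filter_imp with (2 := Rbar_open_interval_locally _ _ _ Ht).
  intros s Hs; symmetry; now apply Hy. }
replace (first_order_y bA bB z t (x t) (y t))
  with (- xi_integrand bA z x t * y t + bB t)
  by (unfold first_order_y, xi_integrand; ring).
rewrite (Hy t Ht).
apply (variation_of_constants_is_derive lo hi (xi_integrand bA z x) bB a c2 t);
  try assumption.
now apply xi_integrand_continuous.
Qed.

(** The value [z x = -2] is the nonzero equilibrium of the Bernoulli equation. It lies outside the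
    family for every finite [c1], since the formula yields [2 + z x = 4 exp(-gamma) / (2 exp(-gamma)
    - z c1)]. *)
Lemma solves_first_order_x_dichotomy (x : R -> R) :
  solves_first_order_x J bA z x ->
  (forall t, J t -> z * x t = - 2) \/ (forall t, J t -> 2 + z * x t <> 0).
Proof.
intros Hx.
(* This coefficient comes from the factorization [z (x + z x^2 / 2) = (z x / 2) (2 + z x)]. *)
set (k := fun t => bA t * (z / 2 * x t)).
assert (Hw : forall t, J t -> 2 + z * x t = (2 + z * x a) * exp (RInt k a t)).
{ intros t Ht.
  apply (homogeneous_linear_unique lo hi k (fun t => 2 + z * x t));
    [ | |exact Ha|exact Ht]; intros s Hs.
  - apply (continuous_mult bA); [now apply HA|].
    apply (continuous_mult (fun _ => z / 2)); [apply continuous_const|].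
    now apply solves_first_order_x_continuous.
  - auto_derive; [eexists; now apply Hx|].
    rewrite (is_derive_unique (fun x0 : R => x x0) _ _ (Hx s Hs)); unfold k, first_order_x.
    field. }
destruct (Req_dec (2 + z * x a) 0) as [H0 | H0]; [left | right];
  intros t Ht; specialize (Hw t Ht).
- rewrite H0, Rmult_0_l in Hw; lra.
- rewrite Hw; apply Rmult_integral_contrapositive_currified; [exact H0|].
  apply Rgt_not_eq, exp_pos.
Qed.

(** The constant [c1] is found by inverting the formula at [t = a], where [gamma] vanishes:
    [x(a) = 2 c1 / (2 - z c1)]. *)
Lemma solves_first_order_x_quadrature (x : R -> R) (t : R) :
  solves_first_order_x J bA z x ->
  (forall t, J t -> 2 + z * x t <> 0) -> J t ->
  let c1 := 2 * (x a / (2 + z * x a)) in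
  2 * exp (- gamma bA a t) - z * c1 <> 0 /\
  x t = 2 * c1 * / (2 * exp (- gamma bA a t) - z * c1).
Proof.
intros Hx Hw Ht c1.
pose proof (Hw t Ht) as Hwt.
assert (Hp : x t / (2 + z * x t) = x a / (2 + z * x a) * exp (RInt bA a t)).
{ apply (homogeneous_linear_unique lo hi bA (fun t => x t / (2 + z * x t)));
    [exact HA| |exact Ha|exact Ht]; intros s Hs.
  auto_derive;
    [repeat split; try (eexists; now apply Hx); now apply Hw|].
  rewrite (is_derive_unique (fun x0 : R => x x0) _ _ (Hx s Hs)); unfold first_order_x.
  field; now apply Hw. }
assert (Hc : c1 = 2 * (x t / (2 + z * x t)) * exp (- gamma bA a t)).
{ rewrite Hp; unfold c1, gamma; rewrite exp_Ropp.
  field; split; [apply Rgt_not_eq, exp_pos | now apply Hw]. }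
pose proof (exp_pos (- gamma bA a t)) as He.
(* Expressing [c1] through the values at [t] makes the denominator a manifestly nonzero quotient. *)
assert (HD : 2 * exp (- gamma bA a t) - z * c1
             = 4 * exp (- gamma bA a t) / (2 + z * x t)).
{ rewrite Hc; field; exact Hwt. }
rewrite HD; split.
- apply Rmult_integral_contrapositive_currified; [lra|].
  now apply Rinv_neq_0_compat.
- rewrite Hc; field; split; [exact Hwt | lra].
Qed.

Lemma solves_first_order_y_quadrature (x y : R -> R) (t : R) :
  solves_first_order_system J bA bB z x y -> J t ->
  y t = exp (- xi bA z a x t) * (y a + RInt (y_integrand bA bB z a x) a t).
Proof.
intros [Hx Hy] Ht.
apply (variation_of_constants_unique lo hi (xi_integrand bA z x) bB y a t);
  try assumption.
- now apply xi_integrand_continuous.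
- intros s Hs.
  replace (- xi_integrand bA z x s * y s + bB s)
    with (first_order_y bA bB z s (x s) (y s))
    by (unfold first_order_y, xi_integrand; ring).
  now apply Hy.
Qed.

End GeneralSolution.

Theorem mainTheorem6 :
  forall bA bB : R -> R,
  (* the approximate system is the first-order truncation in z *)
  (forall t x y : R,
     first_order_truncation (fun z => deformed_x bA z t x)
                            (fun z => first_order_x bA z t x) /\
     first_order_truncation (fun z => deformed_y bA bB z t x y)
                            (fun z => first_order_y bA bB z t x y)) /\
  (* its first equation is a Bernoulli equation *)
  (forall z t x : R,
     first_order_x bA z t x = bernoulli_rhs bA (fun s => / 2 * z * bA s) 2 t x) /\
  (* x = 1 / (z u) reduces it to the linear equation for u *)
  (forall (z : R) (lo hi : Rbar) (x u : R -> R),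
     z <> 0 ->
     (forall t : R, Rbar_open_interval lo hi t -> u t <> 0 /\ x t = 1 / (z * u t)) ->
     (solves_first_order_x (Rbar_open_interval lo hi) bA z x <->
      solves_linear_u (Rbar_open_interval lo hi) bA u)) /\
  (* general solution; the only solutions outside the family have z x = -2 *)
  (forall (z a : R) (lo hi : Rbar),
     Rbar_open_interval lo hi a ->
     (forall t : R, Rbar_open_interval lo hi t -> continuous bA t) ->
     (forall t : R, Rbar_open_interval lo hi t -> continuous bB t) ->
     (forall (c1 c2 : R) (x y : R -> R),
        given_by_quadratures (Rbar_open_interval lo hi) bA bB z a c1 c2 x y ->
        quadratures_exist (Rbar_open_interval lo hi) bA bB z a x /\
        solves_first_order_system (Rbar_open_interval lo hi) bA bB z x y) /\
     (forall x y : R -> R,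
        solves_first_order_system (Rbar_open_interval lo hi) bA bB z x y ->
        (forall t : R, Rbar_open_interval lo hi t -> z * x t = - 2) \/
        exists c1 c2 : R,
          given_by_quadratures (Rbar_open_interval lo hi) bA bB z a c1 c2 x y)).
Proof.
intros bA bB; split; [|split; [|split]].
- intros t x y; split.
  + apply first_order_truncation_deformed_x.
  + apply first_order_truncation_deformed_y.
- intros z t x; unfold first_order_x, bernoulli_rhs; ring.
- intros z lo hi x u; apply bernoulli_substitution.
- intros z a lo hi Ha HA HB; split.
  + intros c1 c2 x y Hq.
    (* The equation for [x] comes first: it makes [x] continuous, on which the integrals defining
       [xi] and [y] rely. *)
    assert (Hx : solves_first_order_x (Rbar_open_interval lo hi) bA z x).
    { apply (quadrature_solves_x bA z a lo hi Ha HA c1).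
      intros t Ht; split; now apply (Hq t Ht). }
    split; [now apply quadratures_exist_of_solution|].
    split; [exact Hx|].
    apply (quadrature_solves_y bA bB z a lo hi Ha HA HB c2); [exact Hx|].
    intros t Ht; now apply (Hq t Ht).
  + intros x y Hs.
    destruct (solves_first_order_x_dichotomy bA z a lo hi Ha HA x (proj1 Hs))
      as [H | Hw]; [now left | right].
    (* Both constants are read off at [t = a], where all integrals vanish. *)
    exists (2 * (x a / (2 + z * x a))), (y a); intros t Ht.
    apply and_assoc; split.
    * now apply (solves_first_order_x_quadrature bA z a lo hi Ha HA x t (proj1 Hs)).
    * now apply (solves_first_order_y_quadrature bA bB z a lo hi).
Qed.
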